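(* For every positive integer $t$ there is a constant $c_t>0$, depending only on $t$, such that for every positive integer $r$ such that $2^t(t+1)$ divides $r$, there exist a graph $G$ of treewidth at most $t$ and a nonempty set $A\subseteq V(G)$ such that $$|\Pi_{r,G}[V(G)\to A]|\ \ge\ \frac{1}{(2(t+1))^{t+1}}\; r^{t+1}|A|\ \ge\ c_t\, r^{t+1}|A|^{t+1}.$$
   Context: All graphs are finite, simple and undirected. For a graph $G$, $A\subseteq V(G)$, $u\in V(G)$ and an integer $r\ge 0$, the profile $\pi_{r,G}[u\to A]$ is the function $A\to\{0,\dots,r,+\infty\}$ mapping $a\in A$ to $\mathrm{dist}_G(u,a)$ if $\mathrm{dist}_G(u,a)\le r$, and to $+\infty$ otherwise. For $U\subseteq V(G)$, $\Pi_{r,G}[U\to A]$ is the set of all profiles $\pi_{r,G}[u\to A]$ for $u\in U$, excluding the profile that is constantly $+\infty$. *)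

(* Defs.v *)
From mathcomp Require Import all_boot.

Set Implicit Arguments.
Unset Strict Implicit.
Unset Printing Implicit Defensive.

Record sgraph := SGraph {
  vertex :> finType;
  edge : rel vertex;
  edge_sym : symmetric edge;
  edge_irrefl : irreflexive edge }.

Definition walk (G : sgraph) (u v : G) (n : nat) : bool :=
  [exists p : n.-tuple G, path (@edge G) u p && (last u p == v)].

Lemma connect_walk (G : sgraph) (u v : G) :
  connect (@edge G) u v -> exists n, walk u v n.
Proof.
move=> /connectP[p up ->]; exists (size p).
by apply/existsP; exists (in_tuple p); rewrite up eqxx.
Qed.

(* None stands for +oo, the distance between different components. *)
Definition dist (G : sgraph) (u v : G) : option nat :=
  match @idP (connect (@edge G) u v) with
  | ReflectT uv => Some (ex_minn (connect_walk uv))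
  | ReflectF _ => None
  end.

(* The set {0, ..., r, +oo} is option 'I_r.+1; [insub d] is None when r < d. *)
Definition profile (G : sgraph) (r : nat) (A : {set G}) (u : G) :
    {ffun {a : G | a \in A} -> option 'I_r.+1} :=
  [ffun a => obind insub (dist u (val a))].

Definition profiles (G : sgraph) (r : nat) (U A : {set G}) :
    {set {ffun {a : G | a \in A} -> option 'I_r.+1}} :=
  [set profile r A u | u in U] :\ [ffun=> None].

Definition is_tree (T : sgraph) : Prop :=
  [/\ 0 < #|T|,
      forall x y : T, connect (@edge T) x y
    & forall c : seq T, 2 < size c -> ~ ucycle (@edge T) c].

Record tree_decomposition (G : sgraph) := TreeDecomposition {
  td_tree : sgraph;
  td_treeP : is_tree td_tree;
  bag : td_tree -> {set G};
  bag_vertex : forall v : G, exists x, v \in bag x;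
  bag_edge : forall u v : G, edge u v -> exists x, (u \in bag x) && (v \in bag x);
  bag_connected : forall (v : G) (x y : td_tree), v \in bag x -> v \in bag y ->
    connect [rel x' y' | [&& edge x' y', v \in bag x' & v \in bag y']] x y }.

(* Truncated predecessor: the graph without vertices gets width 0, not -1. *)
Definition width (G : sgraph) (D : tree_decomposition G) : nat :=
  (\max_(x : td_tree D) #|bag x|).-1.

(* Treewidth is the least width of a tree decomposition. *)
Definition treewidth_le (G : sgraph) (t : nat) : Prop :=
  exists D : tree_decomposition G, width D <= t.

(* Main.v *)
Require Import Defs.
From HB Require Import structures.
From mathcomp Require Import all_boot all_order all_algebra.
From mathcomp Require Import zify ring.
Import Order.TTheory GRing.Theory Num.Theory.

(** Write [r = 4 q] and [t = k + 1]. The witness is a tree with [k] additional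
    vertices, the hubs. The tree has a spine, a path with [2 q] vertices [0,
    ..., d]. For every foot [x] on the spine, every height [h] in [[q, 2 q)]
    and every choice of reaches [l_1, ..., l_k] in [[2 q, 4 q)] there is a
    leaf, joined to [x] by a path of length [h] and to the [i]-th hub by a
    path of length [l_i]. The set [A] consists of the two ends of the spine
    and the [k] hubs.

    Deleting the hubs leaves a tree, so the treewidth is at most [k + 1 = t]
    ([treewidth_hubbed_caterpillar]): root that tree, and give each vertex the
    bag formed by itself, its parent and all hubs ([treewidth_apex_forest]).

    The ranges are chosen so that no route through another leaf is a shortcut:
    the leaf above is at distances [x + h], [(d - x) + h] and [l_i] from the
    vertices of [A] ([dist_leaf]). The upper bounds are the obvious walks.
    Each lower bound comes from a 1-Lipschitz function vanishing at the
    target; on a subdivided graph it suffices to give that function on the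
    branch vertices, with increments bounded by the lengths of the subdivided
    edges ([dist_subdivision]).

    All these distances are at most [r], and together they determine [x], [h]
    and the [l_i]. Hence there are at least [2 q * q * (2 q) ^ k] profiles,
    and because [2 (t + 1) <= (t + 1) ^ (t + 1)] this is at least [(t + 1) *
    (r / (2 (t + 1))) ^ (t + 1)], where [#|A| <= t + 1]. The second inequality
    only uses that [#|A|] is bounded in terms of [t]. *)

(** * Treewidth of a forest with apices *)

Section RootedTree.
Set Implicit Arguments.
Unset Strict Implicit.

Variables (V : finType) (root : V) (par : V -> V) (rank : V -> nat).
Hypothesis par_root : par root = root.
Hypothesis rank_par : forall x, x != root -> rank (par x) < rank x.

Definition tree_edge (x y : V) := (x != y) && ((par x == y) || (par y == x)).

Lemma tree_edge_sym : symmetric tree_edge.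
Proof. by move=> x y; rewrite /tree_edge eq_sym orbC. Qed.

Lemma tree_edge_irrefl : irreflexive tree_edge.
Proof. by move=> x; rewrite /tree_edge eqxx. Qed.

Definition rooted_tree : sgraph := SGraph tree_edge_sym tree_edge_irrefl.

Lemma connect_root x : connect tree_edge x root.
Proof.
have [n] := ubnP (rank x); elim: n x => // n IHn x; rewrite ltnS => le_xn.
have [-> // | x_root] := eqVneq x root.
have lt_x := rank_par x_root.
apply: connect_trans (IHn _ (leq_trans lt_x le_xn)).
apply: connect1; rewrite /tree_edge eqxx orTb andbT.
by apply: contraTneq lt_x => <-; rewrite ltnn.
Qed.

Lemma tree_edge_connected x y : connect tree_edge x y.
Proof.
apply: connect_trans (connect_root x) _.
by rewrite (sym_connect_sym tree_edge_sym) connect_root.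
Qed.

Lemma tree_edge_le x y : tree_edge x y -> rank y <= rank x -> y = par x.
Proof.
case/andP=> xy /orP[/eqP // | /eqP par_y] le_yx.
have [y_root | /rank_par] := eqVneq y root.
  by rewrite -par_y y_root par_root eqxx in xy.
by rewrite par_y ltnNge le_yx.
Qed.

(** On a cycle, a vertex of maximal rank would have its parent as both of its
    neighbours. *)
Lemma rooted_tree_is_tree : is_tree rooted_tree.
Proof.
split=> [|x y|c size_c /andP[cyc_c uniq_c]].
- by apply/card_gt0P; exists root.
- exact: tree_edge_connected.
case: c => [|x0 c0] // in size_c cyc_c uniq_c *.
pose top := [arg max_(x > x0 in x0 :: c0) rank x].
have [top_c top_max] : top \in x0 :: c0 /\
    {in x0 :: c0, forall y, rank y <= rank top}.
  by rewrite /top; case: arg_maxnP; rewrite ?mem_head // => i i_c i_max; split.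
have [i c def_c] := rot_to top_c.
have size_c' : 2 < size (top :: c) by rewrite -def_c size_rot.
have cyc_c' : cycle tree_edge (top :: c) by rewrite -def_c rot_cycle.
have uniq_c' : uniq (top :: c) by rewrite -def_c rot_uniq.
have max_c y : y \in top :: c -> rank y <= rank top.
  by rewrite -def_c mem_rot => /top_max.
move: size_c' cyc_c' uniq_c' max_c.
case: c {def_c} => [|y c] //; case/lastP: c => [|c z] // _ cyc uniq_c' max_c.
move: cyc => /= /andP[top_y]; rewrite rcons_path last_rcons => /andP[_ z_top].
have def_y : y = par top.
  by apply: tree_edge_le => //; apply: max_c; rewrite !inE eqxx orbT.
have def_z : z = par top.
  apply: tree_edge_le; first by rewrite tree_edge_sym.
  by apply: max_c; rewrite !inE mem_rcons mem_head !orbT.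
by move: uniq_c'; rewrite def_y def_z /= mem_rcons mem_head andbF.
Qed.

End RootedTree.

Section ApexForest.
Set Implicit Arguments.
Unset Strict Implicit.

(** The decomposition tree has the vertices of [G] themselves as nodes, those of
    [H] included; the bag of [x] is [H] together with [x] and [par x]. A vertex
    outside [H] lies in its own bag and in those of its children, which form a
    star. *)
Lemma treewidth_apex_forest (G : sgraph) (H : {set G}) (root : G)
    (par : G -> G) (rank : G -> nat) :
  par root = root ->
  (forall x, x != root -> rank (par x) < rank x) ->
  (forall x y, edge x y -> [|| x \in H, y \in H, par x == y | par y == x]) ->
  treewidth_le G #|H|.+1.
Proof.
move=> par_root rank_par edgeP.
pose T := rooted_tree par.
pose bag (x : T) : {set G} := H :|: [set x; par x].
have bag_v (v : G) : exists x : T, v \in bag x.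
  by exists v; rewrite !inE eqxx orbT.
have bag_e (u v : G) : edge u v -> exists x : T, (u \in bag x) && (v \in bag x).
  case/edgeP/or4P => [uH | vH | /eqP<- | /eqP<-].
  - by exists v; rewrite !inE uH eqxx orbT.
  - by exists u; rewrite !inE vH eqxx orbT.
  - by exists u; rewrite !inE !eqxx !orbT.
  - by exists v; rewrite !inE !eqxx !orbT.
pose sub v := [rel x y : T | [&& edge x y, v \in bag x & v \in bag y]].
have bag_c (v : G) (x y : T) :
  v \in bag x -> v \in bag y -> connect (sub v) x y.
  have [vH _ _ | vNH] := boolP (v \in H).
    rewrite (@eq_connect _ _ (@edge T)); last first.
      by move=> x' y'; rewrite /= !inE vH !andbT.
    exact: (tree_edge_connected rank_par).
  have sub_sym : symmetric (sub v).
    by move=> x' y'; rewrite /= tree_edge_sym [X in _ && X]andbC.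
  suff to_v z : v \in bag z -> connect (sub v) z v.
    move=> /to_v xv /to_v yv; apply: connect_trans xv _.
    by rewrite (sym_connect_sym sub_sym).
  rewrite !inE (negPf vNH) /= => /orP[/eqP-> // | /eqP def_v].
  have [-> // | zv] := eqVneq z v.
  apply: connect1; apply/and3P; split; rewrite ?inE -?def_v ?eqxx ?orbT //.
  by rewrite /= /tree_edge zv -def_v eqxx.
exists (TreeDecomposition (rooted_tree_is_tree par_root rank_par)
          bag_v bag_e bag_c).
rewrite /width; apply: (@leq_trans #|H|.+2.-1) => //.
rewrite -!subn1 leq_sub2r //; apply/bigmax_leqP => x _ /=.
rewrite (leq_trans (leq_card_setU _ _)) //.
by rewrite -addn2 leq_add2l cards2; case: (_ != _).
Qed.

End ApexForest.
(** * Walks and distances *)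

Section Distance.
Set Implicit Arguments.
Unset Strict Implicit.
Variable G : sgraph.
Implicit Types u v w : G.

Lemma walkP u v n :
  reflect (exists p, [/\ path (@edge G) u p, last u p = v & size p = n])
          (walk u v n).
Proof.
apply: (iffP existsP) => [[p /andP[up /eqP pv]] | [p [up pv /eqP size_p]]].
  by exists p; rewrite size_tuple.
by exists (Tuple size_p); rewrite /= up pv eqxx.
Qed.

Lemma walk_cat u v w m n : walk u v m -> walk v w n -> walk u w (m + n).
Proof.
move=> /walkP[p [up pv <-]] /walkP[q [vq qw <-]].
by apply/walkP; exists (p ++ q); rewrite cat_path last_cat size_cat pv up vq.
Qed.

Lemma walk0 u : walk u u 0.
Proof. by apply/walkP; exists [::]. Qed.

Lemma walk1 u v : edge u v -> walk u v 1.
Proof. by move=> uv; apply/walkP; exists [:: v]; rewrite /= uv. Qed.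

Lemma walk_sym u v n : walk u v n -> walk v u n.
Proof.
case/walkP=> p [up pv <-]; apply/walkP; exists (rev (belast u p)).
rewrite size_rev size_belast -pv rev_path; split=> //.
  by rewrite (eq_path (e' := @edge G)) // => x y; rewrite edge_sym.
case: p {up pv} => //= x p.
by rewrite rev_cons last_rcons.
Qed.

(** A 1-Lipschitz function certifies that a walk is a shortest one. *)
Lemma dist_potential (f : G -> nat) u v n :
  (forall x y, edge x y -> f x <= (f y).+1) ->
  f v = 0 -> f u = n -> walk u v n -> dist u v = Some n.
Proof.
move=> lip fv0 fun_ uvn.
have lower m : walk u v m -> n <= m.
  case/walkP=> p [up pv <-]; rewrite -fun_ -[size p]add0n -fv0 -pv.
  elim: p u {uvn fun_ pv} up => [|x p IHp] u /=; first by rewrite addn0.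
  by case/andP=> /lip ux /IHp xp; rewrite addnS (leq_trans ux).
have uv : connect (@edge G) u v.
  by have /walkP[p [up <- _]] := uvn; apply/connectP; exists p.
rewrite /dist; case: {-}_ / idP => // uv'.
case: ex_minnP => m /lower le_nm /(_ _ uvn) le_mn.
by congr Some; apply/eqP; rewrite eqn_leq le_mn.
Qed.

End Distance.

(** * Subdivisions of a graph with edge lengths *)

Section Subdivision.
Set Implicit Arguments.
Unset Strict Implicit.

Variables (B E : finType) (src tgt : E -> B) (len : E -> nat).
Hypothesis len_gt0 : forall e, 0 < len e.
Hypothesis src_tgt : forall e, src e != tgt e.

(** An edge of length [l] receives [l - 1] inner vertices; the one of index [i]
    is at distance [i + 1] from the source along that edge. *)
Definition svertex : finType := (B + {e : E & 'I_(len e).-1})%type.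

(** The point at distance [j] from the source along [e]; beyond the inner
    vertices it is the target. *)
Definition pt (e : E) (j : nat) : svertex :=
  if j is j'.+1 then
    oapp (fun i => inr (existT (fun e => 'I_(len e).-1) e i)) (inl (tgt e))
      (insub j')
  else inl (src e).

Lemma pt_len e : pt e (len e) = inl (tgt e).
Proof.
by rewrite -[X in pt e X](prednK (len_gt0 e)) /= insubF //= ltnn.
Qed.

Lemma pt_inner e (i : 'I_(len e).-1) : pt e i.+1 = inr (existT _ e i).
Proof. by rewrite /pt valK. Qed.

Variant pt_spec e : nat -> svertex -> Prop :=
  | PtSrc : pt_spec e 0 (inl (src e))
  | PtInner (i : 'I_(len e).-1) : pt_spec e i.+1 (inr (existT _ e i)).

Lemma ptP e j : j < len e -> pt_spec e j (pt e j).
Proof.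
case: j => [|j] lt_j; first exact: PtSrc.
have lt_j' : j < (len e).-1 by rewrite -ltnS prednK.
by rewrite -[j]/(val (Ordinal lt_j')) pt_inner; constructor.
Qed.

Definition sedge (v w : svertex) :=
  (v != w) && [exists e, exists j : 'I_(len e),
    ((v == pt e j) && (w == pt e j.+1)) || ((w == pt e j) && (v == pt e j.+1))].

Lemma sedge_sym : symmetric sedge.
Proof.
move=> v w; rewrite /sedge eq_sym; congr (_ && _).
by apply: eq_existsb => e; apply: eq_existsb => j; rewrite orbC.
Qed.

Lemma sedge_irrefl : irreflexive sedge.
Proof. by move=> v; rewrite /sedge eqxx. Qed.

Definition subdivision : sgraph := SGraph sedge_sym sedge_irrefl.

Lemma sedge_ind (P : svertex -> svertex -> Prop) :
  (forall v w, P v w -> P w v) ->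
  (forall e j, j < len e -> P (pt e j) (pt e j.+1)) ->
  forall v w, sedge v w -> P v w.
Proof.
move=> P_sym P_pt v w /andP[_ /existsP[e /existsP[j]]].
case/orP=> /andP[/eqP-> /eqP->]; first exact: P_pt.
exact/P_sym/P_pt.
Qed.

Lemma sedge_pt e j : j < len e -> sedge (pt e j) (pt e j.+1).
Proof.
move=> lt_j; apply/andP; split; last first.
  apply/existsP; exists e; apply/existsP; exists (Ordinal lt_j).
  by rewrite !eqxx.
(* Consecutive points differ: the position along [e] tells them apart, except
   for the target, where it starts again from 0. *)
pose pos (v : svertex) := if v is inr x then (tagged x).+1 else 0.
have pos_pt i : i < len e -> pos (pt e i) = i.
  by case/ptP.
have [lt_j1 | le_j1] := ltnP j.+1 (len e).
  by apply/eqP=> /(congr1 pos); rewrite !pos_pt // => /n_Sn.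
have -> : j.+1 = len e by apply/eqP; rewrite eqn_leq lt_j.
rewrite pt_len; case: (ptP lt_j) => // {lt_j le_j1}.
by apply: contra_neq (src_tgt e) => -[].
Qed.

Lemma walk_edge e : walk (inl (src e) : subdivision) (inl (tgt e)) (len e).
Proof.
rewrite -pt_len -/(pt e 0).
have : len e <= len e by [].
elim: {1 3 4}(len e) => [_ | j IHj lt_j]; first exact: walk0.
rewrite -addn1; apply: walk_cat (IHj (ltnW lt_j)) _.
by rewrite addn1; apply/walk1/sedge_pt.
Qed.

(** The largest extension of [g] along each subdivided edge that grows at most
    at unit rate from either end. It agrees with [g] at the ends exactly when
    the increment of [g] is at most the length of the edge. *)
Definition extend (g : B -> nat) (v : svertex) : nat :=
  match v with
  | inl b => g b
  | inr x => let e := tag x in let j := (tagged x).+1 in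
             minn (g (src e) + j) (g (tgt e) + (len e - j))
  end.

Lemma extend_pt g e j :
  g (src e) <= g (tgt e) + len e -> g (tgt e) <= g (src e) + len e ->
  j <= len e ->
  extend g (pt e j) = minn (g (src e) + j) (g (tgt e) + (len e - j)).
Proof.
move=> g_s g_t; rewrite leq_eqVlt => /orP[/eqP-> | /ptP[|i] //=]; last by lia.
by rewrite pt_len /=; lia.
Qed.

Lemma dist_subdivision (g : B -> nat) (u v : subdivision) n :
  (forall e, g (src e) <= g (tgt e) + len e /\ g (tgt e) <= g (src e) + len e) ->
  extend g v = 0 -> extend g u = n -> walk u v n -> dist u v = Some n.
Proof.
move=> g_lip; apply: dist_potential => x y xy.
pose P x y := extend g x <= (extend g y).+1 /\ extend g y <= (extend g x).+1.
suff: P x y by case.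
apply: (@sedge_ind P) xy => [v' w' [] // | e j lt_j].
have [g_s g_t] := g_lip e.
by rewrite /P !extend_pt //; try lia; exact: ltnW.
Qed.

(** Here [pe] gives the edge by which a branch vertex hangs from its parent, and
    an edge ending in [H] may be left out of the forest: its inner vertices then
    form a path pending from its source. Vertices of [H] also need a place in the
    decomposition tree; with [pe] undefined they become children of the root.
    The weight [w] is only required to grow along the forest by at least the
    length of each edge, which leaves room for ranks on the inner vertices. *)
Lemma treewidth_subdivision (H : {set B}) (root : B) (pe : B -> option E)
    (w : B -> nat) :
  pe root = None ->
  (forall b, b != root ->
     if pe b is Some e then tgt e = b /\ w (src e) + len e <= w b
     else w root < w b) ->
  (forall e, tgt e \in H \/ pe (tgt e) = Some e) ->
  treewidth_le subdivision #|H|.+1.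
Proof.
move=> pe_root peP tgtP.
pose par (v : svertex) : svertex := match v with
  | inl b => if pe b is Some e then pt e (len e).-1 else inl root
  | inr x => pt (tag x) (tagged x)
  end.
pose rank (v : svertex) : nat := match v with
  | inl b => w b
  | inr x => w (src (tag x)) + (tagged x).+1
  end.
have rank_pt e j : j < len e -> rank (pt e j) = w (src e) + j.
  by case/ptP=> [|i] //=; rewrite addn0.
have inl_inj : injective (inl : B -> svertex) by move=> x y [].
rewrite -(card_imset (mem H) inl_inj).
apply: (@treewidth_apex_forest subdivision _ (inl root) par rank).
- by rewrite /= pe_root.
- case=> [b b_root | [e i] _].
    have /peP : b != root by apply: contraNneq b_root => ->.
    rewrite /=; case: (pe b) => [e [_ le_w] | //].
    by have len_e := len_gt0 e; rewrite rank_pt; lia.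
  by have lt_i := ltn_ord i; rewrite /= rank_pt; lia.
- apply: sedge_ind => [v v' | e j lt_j].
    by case/or4P=> ->; rewrite ?orbT.
  have [lt_j1 | le_j1] := ltnP j.+1 (len e).
    have lt_j' : j < (len e).-1 by rewrite -ltnS prednK.
    by rewrite (pt_inner (Ordinal lt_j')) /= eqxx !orbT.
  have def_j : j.+1 = len e by apply/eqP; rewrite eqn_leq lt_j.
  rewrite def_j pt_len; have [tH | pe_t] := tgtP e.
    by rewrite imset_f ?orbT.
  by rewrite /= pe_t -def_j eqxx !orbT.
Qed.

End Subdivision.
(** * The caterpillar with hubs *)

Section Caterpillar.
Set Implicit Arguments.
Unset Strict Implicit.

Variables q k : nat.
Hypothesis q_gt0 : 0 < q.

Let d := (2 * q).-1.

Definition leaf_type : finType :=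
  ('I_d.+1 * 'I_q * {ffun 'I_k -> 'I_(2 * q)})%type.
Definition foot (u : leaf_type) : 'I_d.+1 := u.1.1.
Definition height (u : leaf_type) : nat := q + u.1.2.
Definition reach (u : leaf_type) (i : 'I_k) : nat := 2 * q + u.2 i.

Lemma foot_lt u : foot u < 2 * q.
Proof. by rewrite (leq_trans (ltn_ord _)) // prednK // muln_gt0. Qed.

Lemma height_bounds u : q <= height u < 2 * q.
Proof. by have := ltn_ord u.1.2; rewrite /height; lia. Qed.

Lemma reach_bounds u i : 2 * q <= reach u i < 4 * q.
Proof. by have := ltn_ord (u.2 i); rewrite /reach; lia. Qed.

Definition base : finType := ('I_d.+1 + leaf_type + 'I_k)%type.
Definition spine (x : 'I_d.+1) : base := inl (inl x).
Definition leaf (u : leaf_type) : base := inl (inr u).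
Definition hub (i : 'I_k) : base := inr i.

Definition arc : finType := ('I_d + leaf_type * option 'I_k)%type.
Definition arc_src (e : arc) : base :=
  match e with
  | inl j => spine (widen_ord (leqnSn d) j)
  | inr (u, None) => spine (foot u)
  | inr (u, Some _) => leaf u
  end.
Definition arc_tgt (e : arc) : base :=
  match e with
  | inl j => spine (lift ord0 j)
  | inr (u, None) => leaf u
  | inr (u, Some i) => hub i
  end.
Definition arc_len (e : arc) : nat :=
  match e with
  | inl _ => 1
  | inr (u, None) => height u
  | inr (u, Some i) => reach u i
  end.

Lemma arc_len_gt0 e : 0 < arc_len e.
Proof. by case: e => [j|[u [i|]]] //=; rewrite ?/reach ?/height; lia. Qed.

Lemma arc_src_tgt e : arc_src e != arc_tgt e.
Proof.
case: e => [j|[u [i|]]] //=.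
by apply/eqP=> -[]; rewrite /bump /=; lia.
Qed.

Definition hubbed_caterpillar : sgraph := subdivision arc_src arc_tgt arc_len.
Definition vtx (b : base) : hubbed_caterpillar := inl b.

Lemma treewidth_hubbed_caterpillar : treewidth_le hubbed_caterpillar k.+1.
Proof.
have <- : #|hub @: 'I_k| = k by rewrite card_imset ?card_ord // => i j [].
pose pe (b : base) : option arc := match b with
  | inl (inl x) => omap inl (unlift ord0 x)
  | inl (inr u) => Some (inr (u, None))
  | inr _ => None
  end.
pose w (b : base) : nat := match b with
  | inl (inl x) => x
  | inl (inr u) => foot u + height u
  | inr _ => 1
  end.
apply: (@treewidth_subdivision _ _ _ _ _ arc_len_gt0 _ (spine ord0) pe w).
- by rewrite /= unlift_none.
- case=> [[x|u]|i] //= x0.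
  case: unliftP x0 => [j -> _|->] //=.
  by split=> //; rewrite /bump /=; lia.
- case=> [j|[u [i|]]] /=; [right | left | by right].
    by rewrite liftK.
  exact: imset_f.
Qed.

Definition terminal (s : option (option 'I_k)) : hubbed_caterpillar :=
  vtx match s with
      | None => spine ord0
      | Some None => spine ord_max
      | Some (Some i) => hub i
      end.

Definition leaf_dist (u : leaf_type) (s : option (option 'I_k)) : nat :=
  match s with
  | None => foot u + height u
  | Some None => (d - foot u) + height u
  | Some (Some i) => reach u i
  end.

Lemma walk_spine (x y : 'I_d.+1) :
  x <= y -> walk (vtx (spine x)) (vtx (spine y)) (y - x).
Proof.
move: y; suff walk_n n (y : 'I_d.+1) :
    (y : nat) = x + n -> walk (vtx (spine x)) (vtx (spine y)) n.
  by move=> y le_xy; apply: walk_n; rewrite subnKC.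
elim: n y => [|n IHn] y def_y.
  by rewrite addn0 in def_y; rewrite (val_inj def_y); apply: walk0.
case: (unliftP ord0 y) def_y => [j ->|->] def_y; last by rewrite addnS in def_y.
rewrite -[X in walk _ _ X]addn1.
apply: walk_cat (IHn (widen_ord (leqnSn d) j) _) _.
  by move: def_y; rewrite /= /bump /=; lia.
exact: (walk_edge arc_len_gt0 arc_src_tgt (inl j)).
Qed.

Lemma walk_leaf u s : walk (vtx (leaf u)) (terminal s) (leaf_dist u s).
Proof.
have down : walk (vtx (leaf u)) (vtx (spine (foot u))) (height u).
  exact/walk_sym/(walk_edge arc_len_gt0 arc_src_tgt (inr (u, None))).
case: s => [[i|]|] /=.
- exact: (walk_edge arc_len_gt0 arc_src_tgt (inr (u, Some i))).
- rewrite addnC; apply: walk_cat down _.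
  by apply: walk_spine; rewrite -ltnS.
- rewrite addnC; apply: walk_cat down _; apply: walk_sym.
  by rewrite -[X in walk _ _ X]subn0; apply: walk_spine.
Qed.

(** On the leaves, and on the spine if the target is one of its ends, these are
    the intended distances to [terminal s]. The other values are constants in
    the middle of what their neighbours allow: leaves have values in
    [[q, 4 q)] for an end of the spine and in [[2 q, 4 q)] for a hub, which are
    within [2 q], the least reach, of [3 q] and of [2 q] respectively; and the
    latter are within [q], the least height, of [3 q]. *)
Definition potential (s : option (option 'I_k)) (b : base) : nat :=
  match b, s with
  | inl (inl x), None => x
  | inl (inl x), Some None => d - x
  | inl (inl x), Some (Some _) => 3 * q
  | inl (inr u), _ => leaf_dist u s
  | inr j, Some (Some i) => if j == i then 0 else 2 * q
  | inr _, _ => 3 * q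
  end.

Lemma dist_leaf u s :
  dist (vtx (leaf u)) (terminal s) = Some (leaf_dist u s).
Proof.
apply: (dist_subdivision arc_len_gt0 (g := potential s)) (walk_leaf u s) => //.
  case=> [j|[v [j|]]] /=.
  - by case: s => [[i|]|] /=; rewrite /bump /=; lia.
  - have := foot_lt v; have := height_bounds v; have := reach_bounds v j.
    case: s => [[i|]|] /=; rewrite /d; try lia.
    have := reach_bounds v i; case: eqP => [->|_]; lia.
  - have := height_bounds v.
    by case: s => [[i|]|] /=; first have := reach_bounds v i; lia.
case: s => [[i|]|] //=; first by rewrite eqxx.
by rewrite subnn.
Qed.

Lemma leaf_dist_le u s : leaf_dist u s <= 4 * q.
Proof.
have := foot_lt u; have := height_bounds u.
by case: s => [[i|]|] /=; [have := reach_bounds u i | |]; rewrite /d; lia.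
Qed.

(** The distances to the two ends of the spine have sum [d + 2 h] and difference
    [2 x - d]. *)
Lemma leaf_dist_inj u v : leaf_dist u =1 leaf_dist v -> u = v.
Proof.
move=> eq_uv.
have eq_reach i : reach u i = reach v i := eq_uv (Some (Some i)).
have [eq_foot eq_height] : foot u = foot v :> nat /\ height u = height v.
  have := eq_uv None; have := eq_uv (Some None) => /=.
  by have := foot_lt u; have := foot_lt v; rewrite /d; lia.
case: u v eq_foot eq_height eq_reach {eq_uv} => [[x h] l] [[x' h'] l'].
rewrite /foot /height /reach /= => /ord_inj-> /addnI/ord_inj-> eq_reach.
by congr (_, _); apply/ffunP=> i; apply/ord_inj/(addnI (eq_reach i)).
Qed.

Definition terminals : {set hubbed_caterpillar} :=
  [set terminal s | s in predT].

Lemma card_terminals : #|terminals| <= k.+2.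
Proof.
by rewrite (leq_trans (leq_imset_card _ _)) // !card_option card_ord.
Qed.

Lemma card_leaf_type : #|leaf_type| = 2 * q * q * (2 * q) ^ k.
Proof.
by rewrite !card_prod card_ffun !card_ord prednK // muln_gt0.
Qed.

Lemma card_profiles_terminals :
  2 * q * q * (2 * q) ^ k <=
    #|profiles (4 * q) [set: hubbed_caterpillar] terminals|.
Proof.
have term_in s : terminal s \in terminals by apply: imset_f.
pose P u := profile (4 * q) terminals (vtx (leaf u)).
have PE u s : P u (exist _ (terminal s) (term_in s)) =
              Some (inord (leaf_dist u s)).
  rewrite ffunE /= dist_leaf /= insubT ?ltnS ?leaf_dist_le // => le_us.
  by congr Some; apply: val_inj; rewrite /= inordK.
have P_inj : injective P.
  move=> u v eq_P; apply: leaf_dist_inj => s.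
  have := PE u s; rewrite eq_P PE => -[/(congr1 val)].
  by rewrite /= !inordK ?ltnS ?leaf_dist_le.
rewrite -card_leaf_type -(card_imset predT P_inj).
apply: subset_leq_card; apply/subsetP=> _ /imsetP[u _ ->].
rewrite in_setD1; apply/andP; split; last by apply: imset_f; rewrite inE.
by apply/eqP=> /ffunP/(_ (exist _ (terminal None) (term_in None)));
   rewrite PE ffunE.
Qed.

End Caterpillar.
Local Open Scope ring_scope.

Theorem theorem36 (R : realFieldType) (t : nat) (t_gt0 : (0 < t)%N) :
  exists c : R, 0 < c /\
    forall r : nat, (0 < r)%N -> (2 ^ t * t.+1 %| r)%N ->
      exists (G : sgraph) (A : {set G}),
        [/\ treewidth_le G t,
            A != set0,
            #|profiles r [set: G] A|%:R
              >= 1 / (2 * t.+1)%:R ^+ t.+1 * (r%:R ^+ t.+1 * #|A|%:R) :> R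
          & 1 / (2 * t.+1)%:R ^+ t.+1 * (r%:R ^+ t.+1 * #|A|%:R)
              >= c * (r%:R ^+ t.+1 * #|A|%:R ^+ t.+1) :> R].
Proof.
case: t t_gt0 => // k _.
(* Since [#|A| <= k.+2], dividing by [k.+2 ^ k.+1] absorbs the [k.+1] surplus
   factors [#|A|]. *)
pose M : R := 1 / (2 * k.+2)%:R ^+ k.+2.
have M_gt0 : 0 < M by rewrite divr_gt0 // exprn_gt0 // ltr0n.
exists (M / k.+2%:R ^+ k.+1); split.
  by rewrite divr_gt0 // exprn_gt0 // ltr0n.
move=> r r_gt0 dvd_r.
have /dvdnP[q def_r] : (4 %| r)%N.
  apply: dvdn_trans dvd_r.
  case: k {M M_gt0} => [|k]; first by [].
  by rewrite !expnS mulnA -mulnA dvdn_mulr.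
rewrite mulnC in def_r; subst r.
have q_gt0 : (0 < q)%N by lia.
exists (hubbed_caterpillar q k), (terminals q k); split.
- exact: treewidth_hubbed_caterpillar.
- by apply/set0Pn; exists (terminal q None); apply: imset_f.
- rewrite div1r ler_pdivrMl ?exprn_gt0 ?ltr0n // -!natrX -!natrM ler_nat.
  apply: leq_trans (leq_mul (leqnn _) (card_profiles_terminals k q_gt0)).
  apply: leq_trans (leq_mul (leqnn _) (card_terminals q k)) _.
  (* Up to the common factor [(2 * q) ^ k.+2 * 2 ^ k.+1], the claim is
     [le_pow]. *)
  have le_pow : (2 * k.+2 <= k.+2 ^ k.+2)%N.
    apply: (@leq_trans (k.+2 ^ 2)%N); last by rewrite leq_exp2l.
    by rewrite expnS expn1 leq_mul2r.
  have -> : ((4 * q) ^ k.+2 * k.+2 =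
      (2 * q) ^ k.+2 * 2 ^ k.+1 * (2 * k.+2))%N.
    rewrite -[4%N]/(2 * 2)%N !expnMn !expnS; ring.
  have -> : ((2 * k.+2) ^ k.+2 * (2 * q * q * (2 * q) ^ k) =
      (2 * q) ^ k.+2 * 2 ^ k.+1 * k.+2 ^ k.+2)%N.
    rewrite !expnMn !expnS; ring.
  by rewrite leq_mul2l le_pow orbT.
- set N := (4 * q)%:R ^+ k.+2 : R.
  have N_gt0 : 0 < N by rewrite exprn_gt0 // ltr0n muln_gt0.
  rewrite -/M -mulrA ler_pM2l // mulrCA ler_pM2l // mulrC.
  rewrite ler_pdivrMr ?exprn_gt0 ?ltr0n // exprS ler_wpM2l ?ler0n //.
  by rewrite -!natrX ler_nat leq_exp2r // card_terminals.
Qed.
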